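(* Let $m\ge 0$ and $r\ge 1$ be integers and let $K$ be a simplicial complex. Let $\mathrm{pr}_1,\dots,\mathrm{pr}_r:K^r\to K$ be the coordinate projections. Then $$\mathrm{TC}_r^m(K)=\mathrm{SD}_m(\mathrm{pr}_1,\mathrm{pr}_2,\dots,\mathrm{pr}_r).$$
   Context: Simplicial complexes are abstract simplicial complexes; the complex $K$ is assumed edge-path connected (any two vertices are joined by a finite chain of edges). Subcomplexes used in coverings and the test complexes $P$ below need not be connected. Two simplicial maps $\varphi,\psi:A\to B$ are contiguous, $\varphi\sim_c\psi$, if for every simplex $\{v_0,\dots,v_k\}$ of $A$ the set $\{\varphi(v_0),\dots,\varphi(v_k),\psi(v_0),\dots,\psi(v_k)\}$ is a simplex of $B$. They are in the same contiguity class, $\varphi\sim\psi$, if there is a finite sequence of simplicial maps $A\to B$ starting at $\varphi$ and ending at $\psi$ in which consecutive maps are contiguous. For simplicial maps $\varphi_1,\dots,\varphi_n:A\to B$, the sequential $m$-contiguity distance $\mathrm{SD}_m(\varphi_1,\dots,\varphi_n)$ is the least integer $k\ge 0$ such that there is a covering of $A$ by subcomplexes $A_0,\dots,A_k$ with the property that, for each $j$ and for every simplicial map $\eta:P\to A_j$ from an $m$-dimensional simplicial complex $P$, the maps $\varphi_1\circ\eta,\dots,\varphi_n\circ\eta:P\to B$ are all in the same contiguity class; it is $\infty$ if there is no such covering. $K^r$ denotes the $r$-fold categorical product: its vertices are $r$-tuples of vertices of $K$, and a finite nonempty set of such tuples is a simplex iff for each coordinate the set of its coordinate entries is a simplex of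 $K$. The sequential $m$-discrete topological complexity $\mathrm{TC}_r^m(K)$ is the least integer $k\ge 0$ such that $K^r$ can be covered by subcomplexes $\Omega_0,\dots,\Omega_k$, for each of which there exists a simplicial map $\sigma_j:\Omega_j\to K$ such that for every simplicial map $\eta:P\to\Omega_j$ from an $m$-dimensional simplicial complex $P$ one has $\Delta\circ\sigma_j\circ\eta\sim\iota_j\circ\eta$, where $\iota_j:\Omega_j\hookrightarrow K^r$ is the inclusion and $\Delta:K\to K^r$ is the diagonal map; it is $\infty$ if there is no such covering. *)

(* Defs.v *)
From HB Require Import structures.
From mathcomp Require Import all_boot finmap.
From mathcomp Require Import boolp.

Set Implicit Arguments.
Unset Strict Implicit.
Unset Printing Implicit Defensive.

Local Open Scope fset_scope.

(* Every element of the type [vertex K] is a vertex ([simplex1]); classically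
   every type carries a choiceType structure, so this is no restriction on the
   vertex set, which may be infinite or empty. *)
Record scomplex := SComplex {
  vertex : choiceType;
  simplex : {fset vertex} -> Prop;
  simplex_neq0 : forall s, simplex s -> s != fset0;
  simplex1 : forall v : vertex, simplex [fset v];
  simplexS : forall s t : {fset vertex},
    simplex s -> t `<=` s -> t != fset0 -> simplex t }.

Record smap (A B : scomplex) := SMap {
  smap_fun :> vertex A -> vertex B;
  smap_simplex : forall s : {fset vertex A},
    simplex s -> simplex [fset smap_fun v | v in s] }.

Lemma scomp_simplex (A B C : scomplex) (g : smap B C) (f : smap A B)
    (s : {fset vertex A}) :
  simplex s -> simplex [fset g (f v) | v in s].
Proof.
move=> /(smap_simplex f) /(smap_simplex g); congr simplex.
by rewrite -imfset_comp.
Qed.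

Definition scomp (A B C : scomplex) (g : smap B C) (f : smap A B) : smap A C :=
  SMap (scomp_simplex g f).

Definition contiguous (A B : scomplex) (f g : smap A B) : Prop :=
  forall s : {fset vertex A}, simplex s ->
    simplex ([fset f v | v in s] `|` [fset g v | v in s]).

Definition same_class (A B : scomplex) (f g : smap A B) : Prop :=
  exists (N : nat) (h : nat -> smap A B),
    [/\ h 0 = f, h N = g & forall i, i < N -> contiguous (h i) (h i.+1)].

Definition edge_path_connected (K : scomplex) : Prop :=
  forall u v : vertex K, exists (N : nat) (p : nat -> vertex K),
    [/\ p 0 = u, p N = v & forall i, i < N -> simplex [fset p i; p i.+1]].

(* The dimension is exactly m; in particular P is nonempty. *)
Definition has_dim (P : scomplex) (m : nat) : Prop :=
  (exists2 s : {fset vertex P}, simplex s & #|` s| = m.+1) /\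
  (forall s : {fset vertex P}, simplex s -> #|` s| <= m.+1).

(* A subcomplex may be empty and need not contain all the vertices of K. *)
Record subcomplex (K : scomplex) := SubComplex {
  sub_simplex : {fset vertex K} -> Prop;
  sub_simplex_sub : forall s, sub_simplex s -> simplex s;
  sub_simplexS : forall s t : {fset vertex K},
    sub_simplex s -> t `<=` s -> t != fset0 -> sub_simplex t }.

Section SubcomplexAsComplex.
Variables (K : scomplex) (L : subcomplex K).

Definition sub_vertex := {v : vertex K | `[< sub_simplex L [fset v] >]}.

Definition sub_vertex_simplex (s : {fset sub_vertex}) : Prop :=
  sub_simplex L [fset val v | v in s].

Lemma sub_vertex_simplex_neq0 s : sub_vertex_simplex s -> s != fset0.
Proof.
move=> /sub_simplex_sub /simplex_neq0; apply: contra => /eqP ->.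
by rewrite imfset0.
Qed.

Lemma sub_vertex_simplex1 (v : sub_vertex) : sub_vertex_simplex [fset v].
Proof. by rewrite /sub_vertex_simplex imfset_fset1; apply/asboolP/(valP v). Qed.

Lemma sub_vertex_simplexS (s t : {fset sub_vertex}) :
  sub_vertex_simplex s -> t `<=` s -> t != fset0 -> sub_vertex_simplex t.
Proof.
move=> ss ts /fset0Pn [v vt]; apply: (sub_simplexS ss).
  by apply: subset_imfset => x; apply: (fsubsetP ts).
by apply/fset0Pn; exists (val v); apply/imfsetP; exists v.
Qed.

Definition complex_of_sub : scomplex :=
  SComplex sub_vertex_simplex_neq0 sub_vertex_simplex1 sub_vertex_simplexS.

Lemma incl_simplex (s : {fset vertex complex_of_sub}) :
  simplex s -> simplex [fset (val v : vertex K) | v in s].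
Proof. exact: sub_simplex_sub. Qed.

Definition incl : smap complex_of_sub K := SMap incl_simplex.

End SubcomplexAsComplex.

Coercion complex_of_sub : subcomplex >-> scomplex.

(* Each simplex of K, not merely each vertex, lies in one of the pieces. *)
Definition covers (K : scomplex) (k : nat) (L : 'I_k.+1 -> subcomplex K) : Prop :=
  forall s : {fset vertex K}, simplex s -> exists j, sub_simplex (L j) s.

Section CategoricalProduct.
Variables (K : scomplex) (r : nat).

Local Notation Kr := {ffun 'I_r -> vertex K}.

Definition prod_simplex (s : {fset Kr}) : Prop :=
  s != fset0 /\ forall i : 'I_r, simplex [fset (x : Kr) i | x in s].

Lemma prod_simplex_neq0 s : prod_simplex s -> s != fset0.
Proof. by case. Qed.

Lemma prod_simplex1 (x : Kr) : prod_simplex [fset x].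
Proof.
split=> [|i]; last by rewrite imfset_fset1; apply: simplex1.
by apply/fset0Pn; exists x; rewrite inE.
Qed.

Lemma prod_simplexS (s t : {fset Kr}) :
  prod_simplex s -> t `<=` s -> t != fset0 -> prod_simplex t.
Proof.
move=> [_ ss] ts t0; split=> // i; apply: (simplexS (ss i)).
  by apply: subset_imfset => x; apply: (fsubsetP ts).
by have /fset0Pn [x xt] := t0; apply/fset0Pn; exists (x i); apply/imfsetP; exists x.
Qed.

Definition cprod : scomplex :=
  SComplex prod_simplex_neq0 prod_simplex1 prod_simplexS.

Lemma proj_simplex (i : 'I_r) (s : {fset vertex cprod}) :
  simplex s -> simplex [fset (x : Kr) i | x in s].
Proof. by case. Qed.

Definition proj (i : 'I_r) : smap cprod K := SMap (proj_simplex i).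

Definition diag_fun (v : vertex K) : vertex cprod := [ffun=> v].

Lemma diag_simplex (s : {fset vertex K}) :
  simplex s -> simplex [fset diag_fun v | v in s].
Proof.
move=> ss; split=> [|i].
  have /fset0Pn [v vs] := simplex_neq0 ss.
  by apply/fset0Pn; exists (diag_fun v); apply/imfsetP; exists v.
rewrite -imfset_comp.
suff -> : [fset ((fun x : Kr => x i) \o diag_fun) v | v in s]
          = s by [].
by rewrite -[RHS]imfset_id; apply: eq_imfset => // v /=; rewrite ffunE.
Qed.

Definition diag : smap K cprod := SMap diag_simplex.

End CategoricalProduct.

(* The least natural number satisfying P, and None (standing for infinity) if
   there is none. *)
Definition least (P : nat -> Prop) : option nat :=
  match pselect (exists n, `[< P n >]) with
  | left exP => Some (ex_minn exP)
  | right _ => None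
  end.

Definition SD (m : nat) (A B : scomplex) (n : nat) (phi : 'I_n -> smap A B) :
    option nat :=
  least (fun k => exists L : 'I_k.+1 -> subcomplex A,
    covers L /\
    forall (j : 'I_k.+1) (P : scomplex) (eta : smap P (L j)), has_dim P m ->
      forall a b : 'I_n,
        same_class (scomp (phi a) (scomp (incl (L j)) eta))
                   (scomp (phi b) (scomp (incl (L j)) eta))).

Definition TC (m r : nat) (K : scomplex) : option nat :=
  least (fun k => exists Omega : 'I_k.+1 -> subcomplex (cprod K r),
    covers Omega /\
    forall j : 'I_k.+1, exists sigma : smap (Omega j) K,
      forall (P : scomplex) (eta : smap P (Omega j)), has_dim P m ->
        same_class (scomp (diag K r) (scomp sigma eta))
                   (scomp (incl (Omega j)) eta)).

(* Main.v *)
Require Import Defs.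
From mathcomp Require Import all_boot.
From mathcomp Require Import finmap boolp.

(* A map into [cprod K r] is a tuple of maps into K, and contiguity classes can
   be tested coordinatewise. Hence [diag \o sigma \o eta ~ incl \o eta] says that
   every [proj i \o incl \o eta] is in the class of [sigma \o eta]; conversely, if
   all these composites are in one class then [sigma := proj i0 \o incl] works.
   So the same coverings are admissible for TC and for SD. *)

Set Implicit Arguments.
Unset Strict Implicit.
Unset Printing Implicit Defensive.

Local Open Scope fset_scope.

Section ContiguityClass.
Variables A B : scomplex.
Implicit Types f g h : smap A B.

(** Contiguity sees only the underlying functions, and for equal functions the union collapses to
    the image of a simplex. Pointwise equal maps can thus be exchanged within a class without an
    equality of records. *)
Lemma contiguous_eqfun f g : f =1 g -> contiguous f g.
Proof.
move=> fg s ss; have -> : [fset g v | v in s] = [fset f v | v in s].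
  by apply: eq_imfset => // v /=; rewrite fg.
by rewrite fsetUid; apply: smap_simplex.
Qed.

Lemma contiguous_refl f : contiguous f f.
Proof. exact: contiguous_eqfun. Qed.

Lemma contiguous_sym f g : contiguous f g -> contiguous g f.
Proof. by move=> fg s /fg; rewrite fsetUC. Qed.

Lemma same_class_refl f : same_class f f.
Proof. by exists 0, (fun=> f). Qed.

Lemma contiguous_same_class f g h :
  contiguous f g -> same_class g h -> same_class f h.
Proof.
move=> fg [N [p [p0 pN pc]]].
exists N.+1, (fun i => if i is j.+1 then p j else f).
by split=> // -[_|i] /=; [rewrite p0 | apply: pc].
Qed.

Lemma same_class_trans g f h :
  same_class f g -> same_class g h -> same_class f h.
Proof.
move=> [N [p [<- <- pc]]] gh; elim: N p pc gh => [//|N IH] p pc gh.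
apply: (contiguous_same_class (pc 0 _)) => //.
exact: (IH (fun i => p i.+1) (fun i => pc i.+1)).
Qed.

Lemma same_class_eqfun f g : f =1 g -> same_class f g.
Proof.
by move=> /contiguous_eqfun /contiguous_same_class; apply; apply: same_class_refl.
Qed.

(** The chain is reversed by induction: first its tail, back to [p 1], then the first link, by
    symmetry of contiguity. *)
Lemma same_class_sym f g : same_class f g -> same_class g f.
Proof.
move=> [N [p [<- <- pc]]]; elim: N p pc => [|N IH] p pc.
  exact: same_class_refl.
apply: (@same_class_trans (p 1)); first exact: (IH (fun i => p i.+1) (fun i => pc i.+1)).
apply: contiguous_same_class (same_class_refl _).
exact/contiguous_sym/pc.
Qed.

End ContiguityClass.

Lemma contiguous_scompl (A B C : scomplex) (k : smap B C) (f g : smap A B) :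
  contiguous f g -> contiguous (scomp k f) (scomp k g).
Proof.
move=> fg s /fg /(smap_simplex k); congr simplex.
by rewrite imfsetU -!imfset_comp.
Qed.

Lemma same_class_scompl (A B C : scomplex) (k : smap B C) (f g : smap A B) :
  same_class f g -> same_class (scomp k f) (scomp k g).
Proof.
move=> [N [p [<- <- pc]]]; exists N, (fun i => scomp k (p i)).
by split=> // i /pc /contiguous_scompl; apply.
Qed.

Section MapsToProduct.
Variables (A K : scomplex) (r : nat).

Definition tuple_fun (F : 'I_r -> smap A K) (v : vertex A) :
  vertex (cprod K r) := [ffun i => F i v].

Lemma tuple_simplex (F : 'I_r -> smap A K) (s : {fset vertex A}) :
  simplex s -> simplex [fset tuple_fun F v | v in s].
Proof.
move=> ss; split=> [|i].
  have /fset0Pn [v vs] := simplex_neq0 ss.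
  by apply/fset0Pn; exists (tuple_fun F v); apply/imfsetP; exists v.
rewrite -imfset_comp; move: (smap_simplex (F i) ss); congr simplex.
by apply: eq_imfset => // v /=; rewrite ffunE.
Qed.

(** The map given by the universal property of the categorical product. *)
Definition tuple_smap (F : 'I_r -> smap A K) : smap A (cprod K r) :=
  SMap (tuple_simplex F).

Lemma tuple_smap_eta (f : smap A (cprod K r)) :
  tuple_smap (fun i => scomp (proj K i) f) =1 f.
Proof. by move=> v; apply/ffunP => i; rewrite ffunE. Qed.

(** The [i]-th coordinates of the union of the two images of [s] form the union of its images under
    [F i] and [G i]. *)
Lemma contiguous_tuple (F G : 'I_r -> smap A K) :
  (forall i, contiguous (F i) (G i)) ->
  contiguous (tuple_smap F) (tuple_smap G).
Proof.
move=> FG s ss; split=> [|i].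
  have /fset0Pn [v vs] := simplex_neq0 ss.
  apply/fset0Pn; exists (tuple_fun F v); rewrite in_fsetU.
  by apply/orP; left; apply/imfsetP; exists v.
move: (FG i s ss); congr simplex; rewrite imfsetU -!imfset_comp.
by congr fsetU; apply: eq_imfset => // v /=; rewrite ffunE.
Qed.

Lemma same_class_tuple (F G : 'I_r -> smap A K) :
  (forall i, same_class (F i) (G i)) ->
  same_class (tuple_smap F) (tuple_smap G).
Proof.
move=> /choice [N] /choice [p pP].
(* Chains of different lengths are made parallel by letting each one stay at
   its endpoint. *)
pose H t i := p i (minn t (N i)).
exists (\max_i N i), (fun t => tuple_smap (H t)); split.
- congr tuple_smap; apply/funext => i.
  by rewrite /H min0n; have [] := pP i.
- congr tuple_smap; apply/funext => i.
  by rewrite /H (minn_idPr (leq_bigmax i)); have [] := pP i.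
- move=> t _; apply: contiguous_tuple => i; rewrite /H.
  have [_ _ pc] := pP i; case: (ltnP t (N i)) => tN.
    by rewrite (minn_idPl tN); apply: pc.
  rewrite (minn_idPr (leqW tN)); exact: contiguous_refl.
Qed.

(** Each of [f] and [g] agrees pointwise with the tuple of its projections, hence lies in the class
    of that tuple. *)
Lemma same_class_cprod (f g : smap A (cprod K r)) :
  (forall i, same_class (scomp (proj K i) f) (scomp (proj K i) g)) ->
  same_class f g.
Proof.
move=> /same_class_tuple fg.
apply: same_class_trans (same_class_eqfun (tuple_smap_eta g)).
apply: same_class_trans fg; apply: same_class_eqfun => v.
by rewrite tuple_smap_eta.
Qed.

Lemma proj_diag (f : smap A K) (i : 'I_r) :
  scomp (proj K i) (scomp (diag K r) f) =1 f.
Proof. by move=> v; rewrite /= ffunE. Qed.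

End MapsToProduct.

Lemma TC_piece_iff (m r : nat) (K : scomplex) (L : subcomplex (cprod K r)) :
  0 < r ->
  (exists sigma : smap L K, forall (P : scomplex) (eta : smap P L),
     has_dim P m ->
     same_class (scomp (diag K r) (scomp sigma eta)) (scomp (incl L) eta)) <->
  (forall (P : scomplex) (eta : smap P L), has_dim P m -> forall a b : 'I_r,
     same_class (scomp (proj K a) (scomp (incl L) eta))
                (scomp (proj K b) (scomp (incl L) eta))).
Proof.
move=> r0; split=> [[sigma sigmaP] P eta Pm | projP].
  (* Composing with [proj K i] preserves classes and cancels [diag]. *)
  have sigma_proj i :
      same_class (scomp sigma eta) (scomp (proj K i) (scomp (incl L) eta)).
    apply: same_class_trans (same_class_scompl (proj K i) (sigmaP P eta Pm)).
    exact/same_class_sym/same_class_eqfun/proj_diag.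
  by move=> a b; apply: same_class_trans (sigma_proj b); apply: same_class_sym.
(* This [sigma] is built from [L] alone, so one map serves all [P] and [eta]; [r0] supplies the
   coordinate. *)
pose i0 := Ordinal r0; exists (scomp (proj K i0) (incl L)) => P eta Pm.
apply: same_class_cprod => i; apply: same_class_trans (projP P eta Pm i0 i).
by apply: same_class_eqfun => v; rewrite proj_diag.
Qed.

Theorem theorem6p3 (m r : nat) (hr : 1 <= r) (K : scomplex)
    (hK : edge_path_connected K) :
  TC m r K = SD m (fun i : 'I_r => proj K i).
Proof.
(* Equality of the two predicates on [k] also settles the infinite case; the covering is kept and
   compared piece by piece. *)
congr least; apply/funext => k; apply/propext.
by split=> -[L [Lc LP]]; exists L; split=> // j;
  apply/(TC_piece_iff m (L j) hr); apply: LP.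
Qed.
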